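(* Let $a>-1$ and $\varepsilon\ge0$ be real and let $L\ge2$ be an integer. The transition coefficients $(e_m:g_k)$ between the bases $\{e_m\}$ and $\{g_k\}$ of $\mathcal F(\varepsilon,L)$ are given as follows. (i) For $m\ge1$ and $k\ge1$, $$ (e_m:g_k)=2(L+\varepsilon+m-1)\,(2L+2\varepsilon+m-1)_{k-1}\,\frac{(m-1)!}{(m-k)!}\cdot\frac{(a+1)_k}{(L)_k(L+a)_k(k+2\varepsilon)_k}\;{}_4F_3\left[\begin{matrix} k-m,\ k+1,\ k+a+1,\ 2L+2\varepsilon+m+k-2\\ L+k,\ L+a+k,\ 2k+2\varepsilon+1\end{matrix}\,\Big|\,1\right], $$ where for $k>m$ the right-hand side is understood to be $0$ (because of the factor $1/(m-k)!$). (ii) For $m\ge1$ and $k=0$, $$ (e_m:g_0)=-\frac{2(L+\varepsilon+m-1)(a+1)}{L(L+a)(2\varepsilon+1)}\;{}_4F_3\left[\begin{matrix}1-m,\ 1,\ a+2,\ 2L+2\varepsilon+m-1\\ L+1,\ L+a+1,\ 2\varepsilon+2\end{matrix}\,\Big|\,1\right]. $$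
   Context: $(x)_n=x(x+1)\cdots(x+n-1)$ is the Pochhammer symbol. $A_m=L+\varepsilon+m-1$ for $m=1,2,\dots$. $\mathcal F(\varepsilon,L)$ is the vector space of even rational functions $f(t)$ of a complex variable $t$ that are regular at $t=\infty$ and whose only singularities are simple poles contained in $\{\pm A_m:m\ge1\}$. Two bases of this space are $$e_0(t)\equiv1,\qquad e_m(t)=\frac1{t-A_m}-\frac1{t+A_m}\quad(m\ge1),$$ and $$g_k(t)={}_4F_3\left[\begin{matrix}-k,\ k+2\varepsilon,\ L,\ L+a\\ -t+L+\varepsilon,\ t+L+\varepsilon,\ a+1\end{matrix}\,\Big|\,1\right],\quad k=0,1,2,\dots$$ (terminating series, rational functions of $t$). For $\phi\in\mathcal F(\varepsilon,L)$, $(\phi:g_k)$ denotes the coefficient of $g_k$ in the finite expansion of $\phi$ in the basis $\{g_k\}$. *)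

(* Defs.v *)
(* Rational functions of a complex variable are elements of
   {fraction {poly R[i]}}; their values and poles are defined through
   representations p / q whose denominator does not vanish at the point. *)
From HB Require Import structures.
From mathcomp Require Import all_boot all_order all_algebra.
From mathcomp Require Import complex boolp classical_sets reals.

Set Implicit Arguments.
Unset Strict Implicit.
Unset Printing Implicit Defensive.

Import Order.TTheory GRing.Theory Num.Theory.
Local Open Scope ring_scope.
Local Open Scope complex_scope.

Local Notation "x %:F" := (tofrac x).

Section Hypergeometric.
Variable K : fieldType.

Definition poch (x : K) (n : nat) : K := \prod_(i < n) (x + i%:R).

Definition hyp_term (us ls : seq K) (z : K) (j : nat) : K :=
  (\prod_(u <- us) poch u j) / (\prod_(l <- ls) poch l j) * (z ^+ j / j`!%:R).

(* The terminating series pFq[us; ls | z].  [N] is its order of termination: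
   - N is one of the upper parameters [us], so that all later terms are 0
   (lemma [hypergeom_terminates]). *)
Definition hypergeom (N : nat) (us ls : seq K) (z : K) : K :=
  \sum_(j < N.+1) hyp_term us ls z j.

Lemma hypergeom_terminates (N M : nat) (us ls : seq K) (z : K) :
  - N%:R \in us -> (N <= M)%N -> hypergeom M us ls z = hypergeom N us ls z.
Proof.
move=> us_N leNM; rewrite /hypergeom -!(big_mkord xpredT (hyp_term us ls z)).
rewrite (big_cat_nat _ (n := N.+1)) //=.
rewrite [X in _ + X]big_nat [X in _ + X]big1 ?addr0 // => j /andP[ltNj _]; rewrite /hyp_term.
have -> : \prod_(u <- us) poch u j = 0.
  apply/eqP; rewrite prodf_seq_eq0; apply/hasP; exists (- N%:R) => //=.
  by apply/prodf_eq0; exists (Ordinal ltNj); rewrite //= addNr.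
by rewrite !mul0r.
Qed.

End Hypergeometric.

Section RationalFunctions.
Variable R : realType.

Definition ratfun := {fraction {poly R[i]}}.

Definition tvar : ratfun := ('X : {poly R[i]})%:F.
Definition cst (c : R[i]) : ratfun := (c%:P)%:F.

(* f(z) is defined and equal to v. *)
Definition has_value (f : ratfun) (z v : R[i]) : Prop :=
  exists p q : {poly R[i]},
    [/\ q.[z] != 0, f = p%:F / q%:F & v = p.[z] / q.[z]].

Definition regular_at (f : ratfun) (z : R[i]) : Prop :=
  exists v, has_value f z v.

Definition regular_at_infinity (f : ratfun) : Prop :=
  exists p q : {poly R[i]},
    [/\ q != 0, (size p <= size q)%N & f = p%:F / q%:F].

Definition simple_pole (f : ratfun) (z : R[i]) : Prop :=
  ~ regular_at f z /\ regular_at ((tvar - cst z) * f) z.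

Definition even_ratfun (f : ratfun) : Prop :=
  forall z v, has_value f z v -> has_value f (- z) v.

(* [c] is the family of coefficients of a finite expansion of [phi] in [b]. *)
Definition expansion (b : nat -> ratfun) (phi : ratfun) (c : nat -> R[i]) :
    Prop :=
  exists N : nat, (forall k, (N <= k)%N -> c k = 0) /\
    phi = \sum_(k < N) cst (c k) * b k.

Definition is_basis (F : set ratfun) (b : nat -> ratfun) : Prop :=
  [/\ forall n, F (b n),
      forall phi, F phi -> exists c, expansion b phi c
    & forall c, expansion b 0 c -> forall k, c k = 0].

(* The coefficient (phi : b_k); meaningful when [phi] has a unique finite
   expansion in [b], in particular when [b] is a basis of a space containing
   [phi]. *)
Definition coef (b : nat -> ratfun) (phi : ratfun) (k : nat) : R[i] :=
  xget (fun=> 0) [set c | expansion b phi c]%classic k.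

End RationalFunctions.

Section Bases.
Variables (R : realType) (a eps : R) (L : nat).

Definition A (m : nat) : R := L%:R + eps + m%:R - 1.

Definition Fspace : set (ratfun R) :=
  [set f | [/\ even_ratfun f, regular_at_infinity f
    & forall z, ~ regular_at f z ->
        simple_pole f z /\
        exists2 m : nat, (1 <= m)%N & z = (A m)%:C \/ z = - (A m)%:C]]%classic.

Definition e (m : nat) : ratfun R :=
  if m is 0 then 1
  else (tvar R - cst (A m)%:C)^-1 - (tvar R + cst (A m)%:C)^-1.

Definition g (k : nat) : ratfun R :=
  let r (x : R) := cst x%:C in
  hypergeom k
    [:: - k%:R; r (k%:R + 2 * eps); r L%:R; r (L%:R + a)]
    [:: - tvar R + r (L%:R + eps); tvar R + r (L%:R + eps); r (a + 1)]
    1.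

End Bases.

(* Main.v *)
(* With s = t^2 and x_i = A_(i+1)^2, both bases are triangular over the Newton
   family h_j = 1 / ((x_0 - s) ... (x_(j-1) - s)).  The space F consists exactly
   of the functions Q(s) / ((x_0 - s) ... (x_(n-1) - s)) with deg Q <= n, and
   repeated division of Q by x_i - s expands them in the h_j.  The function e_m
   has a telescoping expansion in the h_j, the series defining g_k is its
   expansion in the h_j, and the latter is inverted by
     sum_i (-1)^i C(N,i) / ((B+i)_i (B+2i+1)_(N-i)) = [N = 0].
   Composing gives (e_m : g_k) as a single sum, which is the stated 4F3 after
   the shift j = k + l of its index (j = 1 + l if k = 0). *)
Require Import Defs.
From HB Require Import structures.
From mathcomp Require Import all_boot all_order all_algebra.
From mathcomp Require Import complex boolp classical_sets reals.
From mathcomp Require Import ring lra.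

Set Implicit Arguments.
Unset Strict Implicit.
Unset Printing Implicit Defensive.

Import Order.TTheory GRing.Theory Num.Theory.
Local Open Scope ring_scope.
Local Open Scope complex_scope.

(** * Pochhammer symbols and binomial coefficients *)

Section Pochhammer.
Variable K : fieldType.
Implicit Types x : K.

Lemma poch0 x : poch x 0 = 1.
Proof. by rewrite /poch big_ord0. Qed.

Lemma pochS x n : poch x n.+1 = poch x n * (x + n%:R).
Proof. by rewrite /poch big_ord_recr. Qed.

Lemma pochD x m n : poch x (m + n) = poch x m * poch (x + m%:R) n.
Proof.
elim: n => [|n IHn]; first by rewrite addn0 poch0 mulr1.
by rewrite addnS !pochS IHn natrD addrA mulrA.
Qed.

Lemma pochSl x n : poch x n.+1 = x * poch (x + 1) n.
Proof. by rewrite -add1n pochD pochS poch0 mul1r addr0. Qed.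

Lemma pochN n k : poch (- n%:R : K) k = (-1) ^+ k * (n ^_ k)%:R.
Proof.
elim: k => [|k IHk]; first by rewrite poch0 ffactn0 mulr1.
rewrite pochS IHk ffactnSr natrM exprS.
have [le_kn | lt_nk] := leqP k n; last by rewrite ffact_small // !(mul0r, mulr0).
by rewrite natrB //; ring.
Qed.

Lemma poch1 n : poch (1 : K) n = n`!%:R.
Proof.
elim: n => [|n IHn]; first by rewrite poch0.
by rewrite pochS IHn factS mulnC natrM -natr1 addrC.
Qed.

Lemma rmorph_poch (K' : fieldType) (f : {rmorphism K -> K'}) x n :
  f (poch x n) = poch (f x) n.
Proof. by rewrite rmorph_prod; apply: eq_bigr => i _; rewrite rmorphD rmorph_nat. Qed.

End Pochhammer.

Lemma poch_gt0 (R : realFieldType) (x : R) n : 0 < x -> 0 < poch x n.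
Proof. by move=> x0; apply: prodr_gt0 => i _; rewrite ltr_wpDr. Qed.

Lemma poch_neq0 (R : realFieldType) (x : R) n : 0 < x -> poch x n != 0.
Proof. by move=> /(poch_gt0 n)/gt_eqF ->. Qed.

(** Multiplied by [k!], both sides are [(k + l)!]. This is how a binomial coefficient turns into the
    upper parameter [k + 1] of the final series. *)
Lemma poch_nat (R : realFieldType) k l : poch (k%:R + 1 : R) l = 'C(k + l, k)%:R * l`!%:R.
Proof.
apply: (@mulfI _ k`!%:R); first by rewrite pnatr_eq0 -lt0n fact_gt0.
rewrite -(poch1 R k) [_ + 1]addrC -pochD !poch1 -(bin_fact (leq_addr l k)) addKn !natrM; ring.
Qed.

Lemma sum_shift (V : nmodType) (T : nat -> V) k m : (k <= m)%N ->
  (forall j, (j < k)%N -> T j = 0) ->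
  \sum_(j < m.+1) T j = \sum_(l < (m - k).+1) T (k + l)%N.
Proof.
move=> le_km T0; rewrite -(big_mkord xpredT T) (big_cat_nat _ (n := k)) ?leqW //=.
rewrite big_nat big1 => [|j /andP[_ /T0 //]]; rewrite add0r -{1}(add0n k) big_addn big_mkord.
by rewrite subSn //; apply: eq_bigr => l _; rewrite addnC.
Qed.

(** Multiplied by [j! i! (n - i)!], both sides become [(j + n)!]. *)
Lemma bin_trinomial j i n : ('C(j + n, j + i) * 'C(j + i, j) = 'C(j + n, j) * 'C(n, i))%N.
Proof.
have [le_in | lt_ni] := leqP i n; last first.
  by rewrite (bin_small lt_ni) muln0 bin_small ?mul0n // ltn_add2l.
apply/eqP; rewrite -(@eqn_pmul2r (j`! * i`! * (n - i)`!)) ?muln_gt0 ?fact_gt0 //; apply/eqP.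
have := @bin_fact (j + n) (j + i); rewrite leq_add2l subnDl => /(_ le_in) H1.
have := @bin_fact (j + i) j (leq_addr _ _); rewrite addKn => H2.
have := @bin_fact (j + n) j (leq_addr _ _); rewrite addKn => H3.
have H4 := bin_fact le_in.
transitivity (j + n)`!; first by rewrite -H1 -H2; ring.
by rewrite -H3 -H4; ring.
Qed.

(** * A pair of mutually inverse triangular matrices *)

Section InverseRelation.
Variable R : realFieldType.
Implicit Types (b : R).

(* For [N = M.+1] each term is [u_(i-1) + u_i] up to the sign, where
   [u_i = 'C(M, i) / poch (b + i + 1) M.+1], so that the sum telescopes. *)
Lemma sum_alt_poch b N : 0 <= b ->
  \sum_(i < N.+1) (-1) ^+ i * 'C(N, i)%:R
     / (poch (b + i%:R) i * poch (b + 2 * i%:R + 1) (N - i)) = (N == 0)%:R.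
Proof.
case: N => [|M] b0.
  by rewrite big_ord_recl big_ord0 !poch0 bin0 expr0 eqxx addr0 !mulr1 divr1.
(* Both ends of the telescoping vanish: [f 0 = 0] by definition, and [f M.+2 = 0] because
   ['C(M, M.+1) = 0]. *)
pose f i := if i is j.+1 then (-1) ^+ j * 'C(M, j)%:R / poch (b + j%:R + 1) M.+1 else 0.
rewrite -(big_mkord xpredT (fun i => (-1) ^+ i * 'C(M.+1, i)%:R
     / (poch (b + i%:R) i * poch (b + 2 * i%:R + 1) (M.+1 - i)))).
rewrite (@telescope_sumr_eq _ _ _ f) // => [|[|j] /andP[_ lt_jM]].
- by rewrite /f bin_small // !(mulr0, mul0r) subr0.
- by rewrite /f !bin0 poch0 subn0 mulr0 !addr0 subr0; field; apply: poch_neq0; lra.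
rewrite /f subSS.
have j0 := ler0n R j.
have M0 := ler0n R M.
have jS : (j.+1)%:R = j%:R + 1 :> R by rewrite -natr1.
(* This symbol is a common denominator: without its last factor, its first factor or its inner
   factor [b + 2j + 2] it is the denominator of [f j.+1], of [f j.+2] and of the summand. *)
have E1 : poch (b + j.+1%:R) M.+2 = poch (b + j%:R + 1) M.+1 * (b + j%:R + M%:R + 2).
  by rewrite pochS jS addrA -!natr1; congr (_ * _); ring.
have E2 : poch (b + j.+1%:R) M.+2 = (b + j%:R + 1) * poch (b + j.+1%:R + 1) M.+1.
  by rewrite pochSl jS addrA.
have E3 : poch (b + j.+1%:R) M.+2 = poch (b + j.+1%:R) j.+1 *
   ((b + 2 * j%:R + 2) * poch (b + 2 * j.+1%:R + 1) (M - j)).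
  have -> : M.+2 = (j.+1 + (M - j).+1)%N by rewrite addSn addnS subnKC.
  rewrite pochD [poch _ (M - j).+1]pochSl jS; congr (_ * (_ * poch _ _)); ring.
have P0 : poch (b + j.+1%:R) M.+2 != 0 by apply: poch_neq0; lra.
have E : (-1) ^+ j.+1 * 'C(M.+1, j.+1)%:R /
  (poch (b + j.+1%:R) j.+1 * poch (b + 2 * j.+1%:R + 1) (M - j)) =
  (-1) ^+ j.+1 * 'C(M.+1, j.+1)%:R * (b + 2 * j%:R + 2) / poch (b + j.+1%:R) M.+2.
  move: P0; rewrite E3 !mulf_eq0 !negb_or => /andP[P1 /andP[P2 P3]].
  by field; rewrite P1 P2 P3.
have F1 : (poch (b + j%:R + 1) M.+1)^-1 = (b + j%:R + M%:R + 2) / poch (b + j.+1%:R) M.+2.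
  move: P0; rewrite E1 !mulf_eq0 !negb_or => /andP[P1 P2].
  by field; rewrite P1 P2.
have F2 : (poch (b + j.+1%:R + 1) M.+1)^-1 = (b + j%:R + 1) / poch (b + j.+1%:R) M.+2.
  move: P0; rewrite E2 !mulf_eq0 !negb_or => /andP[P1 P2].
  by field; rewrite P1 P2.
rewrite E F1 F2 exprS !mulrA -mulrBl; congr (_ / _).
have H : (j%:R + 1) * 'C(M, j.+1)%:R = (M%:R - j%:R) * 'C(M, j)%:R :> R.
  by rewrite -jS -natrM mul_bin_left natrM natrB.
rewrite binS natrD.
transitivity ((-1) ^+ j * (- (b + j%:R + 1) * 'C(M, j.+1)%:R - (j%:R + 1) * 'C(M, j.+1)%:R
  - 'C(M, j)%:R * (b + 2 * j%:R + 2))); first by ring.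
rewrite H; ring.
Qed.

(** This equals [(-k)_j (k + b)_j / j!], the part of the [j]-th term of the series [g k] that
    depends on [k] when [b = 2 * eps]. *)
Definition gcoef b (k j : nat) : R := (-1) ^+ j * 'C(k, j)%:R * poch (k%:R + b) j.

(* The usual weight [(b + 2k) / poch (b + k) n.+1] written without the factor
   [b + 2k], which avoids the quotient 0/0 at [b = k = 0]. *)
Definition ginv b (n k : nat) : R :=
  (-1) ^+ k * 'C(n, k)%:R / (poch (k%:R + b) k * poch (2 * k%:R + b + 1) (n - k)).

(** At [k = 0] the product is empty, so [b = 0] does no harm. *)
Lemma poch_diag_neq0 b k : 0 <= b -> poch (k%:R + b) k != 0.
Proof.
case: k => [|k] b0; first by rewrite poch0 oner_eq0.
by apply: poch_neq0; rewrite ltr_wpDr.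
Qed.

(** Only [j <= k <= n] contributes. With [k = j + i] and [n = j + N], [bin_trinomial] pulls
    ['C(n, j)] out of the sum, and what remains is [sum_alt_poch] at [b + 2 * j]. *)
Lemma ginv_gcoef b M n j : 0 <= b -> (n < M)%N ->
  \sum_(k < M) ginv b n k * gcoef b k j = (n == j)%:R.
Proof.
move=> b0 ltnM.
have [le_jn|lt_nj] := leqP j n; last first.
  rewrite ltn_eqF // big1 // => k _; rewrite /ginv /gcoef.
  have [le_kn|lt_nk] := leqP k n; last by rewrite (bin_small lt_nk) !(mulr0, mul0r).
  by rewrite (bin_small (leq_ltn_trans le_kn lt_nj)) !(mulr0, mul0r).
move: ltnM; rewrite -(subnKC le_jn); move: (n - j)%N => {n le_jn} N ltnM.
pose T k := ginv b (j + N) k * gcoef b k j.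
have -> : \sum_(k < M) T k = \sum_(k < (j + N).+1) T k.
  rewrite -!(big_mkord xpredT T) [LHS](big_cat_nat _ (n := (j + N).+1)) //=.
  rewrite [X in _ + X]big_nat [X in _ + X]big1 ?addr0 // => k /andP[lt_nk _].
  by rewrite /T /ginv (bin_small lt_nk) !(mulr0, mul0r).
rewrite (sum_shift (leq_addr N j)); last first.
  by move=> k lt_kj; rewrite /T /gcoef (bin_small lt_kj) !(mulr0, mul0r).
rewrite addKn.
have bj0 : 0 <= b + 2 * j%:R by have := ler0n R j; lra.
(* The inserted binomial is 1 in the only case that counts, [N = 0]. *)
transitivity ('C(j + N, j)%:R * (N == 0)%:R : R); last first.
  by rewrite -{4}(addn0 j) eqn_add2l; case: eqP => [->|_]; rewrite ?addn0 ?binn ?mulr0 ?mulr1.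
rewrite -(sum_alt_poch N bj0) mulr_sumr; apply: eq_bigr => -[i /= lt_iN] _.
rewrite /T /ginv /gcoef subnDl.
have H := bin_trinomial j i N.
have P0 := poch_diag_neq0 (j + i) b0.
(* The first factor cancels against [gcoef], the second is the one wanted by [sum_alt_poch]. *)
have E : poch ((j + i)%:R + b) (j + i) =
   poch ((j + i)%:R + b) j * poch (b + 2 * j%:R + i%:R) i.
  by rewrite pochD; congr (_ * poch _ _); rewrite natrD; ring.
have Q0 : poch (b + 2 * j%:R + 2 * i%:R + 1) (N - i) != 0.
  by apply: poch_neq0; have := ler0n R i; lra.
have E' : poch (2 * (j + i)%:R + b + 1) (N - i) = poch (b + 2 * j%:R + 2 * i%:R + 1) (N - i).
  by congr poch; rewrite natrD; ring.
rewrite E E'; move: P0; rewrite E mulf_eq0 negb_or => /andP[P1 P2].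
transitivity ((-1) ^+ (j + i) * (-1) ^+ j * ('C(j + N, j + i) * 'C(j + i, j))%:R /
  (poch (b + 2 * j%:R + i%:R) i * poch (b + 2 * j%:R + 2 * i%:R + 1) (N - i))).
  by rewrite natrM; field; rewrite P1 P2 Q0.
rewrite H natrM exprD.
have -> : (-1) ^+ j * (-1) ^+ i * (-1) ^+ j = (-1) ^+ i :> R.
  by rewrite mulrAC -expr2 sqrr_sign mul1r.
by ring.
Qed.

End InverseRelation.

Lemma addr_div_mul (K : fieldType) (q r d w : K) : w != 0 ->
  q / d + r * (d * w)^-1 = (q * w + r) / (d * w).
Proof. by move=> w0; rewrite mulrDl -mulf_div divff // mulr1. Qed.

HB.instance Definition _ (R : realType) :=
  GRing.RMorphism.copy (@cst R) (@tofrac {poly R[i]} \o @polyC R[i]).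

(** * Polynomials in [s = t^2] and even polynomials *)

Section SquareVariable.
Variable R : realType.
Implicit Types (f : ratfun R) (p q Q : {poly R[i]}) (z : R[i]).

Definition ofsq Q : ratfun R := tofrac (Q \Po 'X^2).
HB.instance Definition _ :=
  GRing.RMorphism.copy ofsq (@tofrac {poly R[i]} \o comp_poly 'X^2).

Lemma ofsqE Q : ofsq Q = tofrac (Q \Po 'X^2). Proof. by []. Qed.

Lemma ofsqM : {morph ofsq : p q / p * q}. Proof. exact: rmorphM. Qed.

Lemma ofsqD : {morph ofsq : p q / p + q}. Proof. exact: rmorphD. Qed.

Lemma ofsqB : {morph ofsq : p q / p - q}. Proof. exact: rmorphB. Qed.

Lemma ofsqC c : ofsq c%:P = cst c. Proof. by rewrite ofsqE comp_polyC. Qed.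

Lemma ofsqX : ofsq 'X = tvar R ^+ 2. Proof. by rewrite ofsqE comp_polyX tofracXn. Qed.

Lemma horner_sq Q z : (Q \Po 'X^2).[z] = Q.[z ^+ 2].
Proof. by rewrite horner_comp hornerXn. Qed.

Lemma comp_sq_eq0 Q : (Q \Po 'X^2 == 0) = (Q == 0).
Proof. by rewrite comp_poly_eq0 // size_polyXn. Qed.

Lemma ofsq_eq0 Q : (ofsq Q == 0) = (Q == 0).
Proof. by rewrite tofrac_eq0 comp_sq_eq0. Qed.

Lemma tofrac_divE p q p' q' : q != 0 -> q' != 0 ->
  tofrac p / tofrac q = tofrac p' / tofrac q' :> ratfun R -> p * q' = p' * q.
Proof.
move=> q0 q'0 /eqP; rewrite eqr_div ?tofrac_eq0 // -!tofracM tofrac_eq => /eqP ->.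
by [].
Qed.

Lemma horner_neq0 p z : p.[z] != 0 -> p != 0.
Proof. by apply: contraNneq => ->; rewrite horner0. Qed.

(** The naturals below [size p] are distinct in characteristic zero, which is one root too many for
    a nonzero [p]. *)
Lemma poly_fun_eq0 p : (forall z, p.[z] = 0) -> p = 0.
Proof.
move=> p_z; apply/eqP/negPn/negP => p0.
have := @max_poly_roots _ p [seq n%:R | n <- iota 0 (size p)] p0.
rewrite size_map size_iota ltnn => H; suff: false by []; apply: H.
  by apply/allP => z _; apply/rootP/p_z.
rewrite map_inj_uniq ?iota_uniq // => m n /eqP; rewrite eqr_nat => /eqP //.
Qed.

(** Comparing the values at [z] and [- z] shows that twice the odd part vanishes at every point. *)
Lemma even_polyP p : (forall z, p.[- z] = p.[z]) -> p = even_poly p \Po 'X^2.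
Proof.
move=> p_even; rewrite -[LHS]poly_even_odd.
suff -> : (odd_poly p \Po 'X^2) * 'X = 0 by rewrite addr0.
apply: poly_fun_eq0 => z; have := p_even z.
rewrite -{1 2}[p]poly_even_odd !hornerE !horner_sq sqrrN => /eqP.
rewrite mulrN -subr_eq0 opprD addrACA subrr add0r -opprD oppr_eq0 -mulr2n.
by rewrite mulrn_eq0 /= => /eqP.
Qed.

(** * The Newton family attached to a sequence of nodes *)

Section Nodes.
Variable x : nat -> R[i].

(** With [x i = (L + eps + i)^2] and this choice of sign, [nodal n] at [t^2] is exactly
    [(L + eps - t)_n (L + eps + t)_n], the denominator in the series for [g]. *)
Definition nodal n : {poly R[i]} := \prod_(i < n) ((x i)%:P - 'X).

Definition hbase n : ratfun R := (ofsq (nodal n))^-1.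

Lemma nodalS n : nodal n.+1 = nodal n * ((x n)%:P - 'X).
Proof. by rewrite /nodal big_ord_recr. Qed.

Lemma node_subX_neq0 i : (x i)%:P - 'X != 0 :> {poly R[i]}.
Proof. by rewrite -opprB oppr_eq0 polyXsubC_eq0. Qed.

Lemma nodal_neq0 n : nodal n != 0.
Proof. by apply/prodf_neq0 => i _; apply: node_subX_neq0. Qed.

Lemma size_nodal n : size (nodal n) = n.+1.
Proof.
elim: n => [|n IHn]; first by rewrite /nodal big_ord0 size_poly1.
rewrite nodalS size_mul ?nodal_neq0 ?node_subX_neq0 // IHn.
by rewrite -opprB size_polyN size_XsubC addn2.
Qed.

Lemma size_nodal_sq n : size (nodal n \Po 'X^2) = n.*2.+1.
Proof.
have := size_comp_poly (nodal n) ('X^2); rewrite size_nodal size_polyXn /= muln2 => <-.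
by rewrite prednK // lt0n size_poly_eq0 comp_sq_eq0 nodal_neq0.
Qed.

Lemma root_nodal n z : root (nodal n) z = [exists i : 'I_n, z == x i].
Proof.
rewrite /root horner_prod; apply/prodf_eq0/existsP => -[i Hi].
  by move=> H; exists i; move: H; rewrite !hornerE subr_eq0 eq_sym.
by exists i => //; rewrite !hornerE subr_eq0 eq_sym.
Qed.

(** Reduction to a common denominator. The last clause carries linear independence of the
    [hbase j]. *)
Lemma hbase_sumE n (c : nat -> R[i]) : exists Q, [/\ (size Q <= n.+1)%N,
    \sum_(j < n.+1) cst (c j) * hbase j = ofsq Q / ofsq (nodal n)
  & Q = 0 -> forall j, (j <= n)%N -> c j = 0].
Proof.
elim: n => [|n [Q [szQ sumQ Q0]]].
  exists (c 0)%:P; split; first exact: size_polyC_leq1.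
    by rewrite big_ord_recl big_ord0 addr0 ofsqC.
  by move=> /eqP; rewrite polyC_eq0 => /eqP c0 [|j].
exists (Q * ((x n)%:P - 'X) + (c n.+1)%:P); split.
- rewrite (leq_trans (size_polyD _ _)) // geq_max (leq_trans (size_polyC_leq1 _)) // andbT.
  have [->|Qn0] := eqVneq Q 0; first by rewrite mul0r size_poly0.
  by rewrite size_mul ?node_subX_neq0 // -opprB size_polyN size_XsubC addn2.
- rewrite big_ord_recr /= sumQ /hbase nodalS ofsqD !ofsqM -ofsqC.
  by rewrite addr_div_mul // ofsq_eq0 node_subX_neq0.
(* Evaluation at [x n] kills everything but the last coefficient. *)
move=> E; have cn0 : c n.+1 = 0.
  have := congr1 (fun p => p.[x n]) E.
  by rewrite !hornerE subrr mulr0 add0r.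
have Qn0 : Q = 0.
  move/eqP: E; rewrite cn0 addr0 mulf_eq0 (negPf (node_subX_neq0 n)) orbF.
  by move/eqP.
by move=> j; rewrite leq_eqVlt => /predU1P[-> //|]; apply: Q0.
Qed.

(** Division of [Q] by [x n - 'X] leaves the remainder [Q.[x n]], the coefficient of [hbase n.+1];
    the quotient is expanded by induction. *)
Lemma hbase_expand n Q : (size Q <= n.+1)%N ->
  exists c : nat -> R[i], ofsq Q / ofsq (nodal n) = \sum_(j < n.+1) cst (c j) * hbase j.
Proof.
elim: n Q => [|n IHn] Q szQ.
  exists (fun=> Q`_0); rewrite big_ord_recl big_ord0 addr0 -ofsqC.
  by rewrite -size1_polyC.
pose r := Q.[x n].
have /factor_theorem[q defq] : root (Q - r%:P) (x n) by rewrite /root !hornerE subrr.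
have szq : (size (- q) <= n.+1)%N.
  rewrite size_polyN; have [->|q0] := eqVneq q 0; first by rewrite size_poly0.
  have : (size (Q - r%:P)%R <= n.+2)%N.
    rewrite (leq_trans (size_polyD _ _)) // geq_max szQ size_polyN.
    exact: leq_trans (size_polyC_leq1 _) _.
  by rewrite defq size_mul ?polyXsubC_eq0 // size_XsubC addn2.
have [c Ec] := IHn _ szq.
exists (fun j => if (j <= n)%N then c j else r).
rewrite big_ord_recr /= ltnn; under eq_bigr => i _ do rewrite (ltn_ord i : (i <= n)%N).
rewrite -Ec -ofsqC /hbase nodalS.
have -> : Q = - q * ((x n)%:P - 'X) + r%:P.
  by rewrite mulNr -mulrN opprB -defq subrK.
rewrite ofsqD !ofsqM.
by rewrite addr_div_mul // ofsq_eq0 node_subX_neq0.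
Qed.

End Nodes.
End SquareVariable.

(** * The space as the set of quotients by nodal polynomials *)

Section FspaceDescription.
Variables (R : realType) (eps : R) (L : nat).
Hypotheses (heps : 0 <= eps) (hL : (2 <= L)%N).

(** Nodes are counted from 0 but poles from 1, hence the shift: [node i = (L + eps + i)^2]. *)
Definition node (i : nat) : R[i] := (A eps L i.+1)%:C ^+ 2.

Local Notation nodal := (nodal node).

Lemma AE m : A eps L m.+1 = L%:R + eps + m%:R.
Proof. by rewrite /A -natr1 !addrA addrK. Qed.

Lemma A_gt0 m : 0 < A eps L m.+1.
Proof.
have L0 : 0 < L%:R :> R by rewrite ltr0n (leq_trans _ hL).
by rewrite AE -addrA ltr_pwDl // addr_ge0.
Qed.

Lemma node_inj : injective node.
Proof.
move=> i j /eqP; rewrite /node -!rmorphXn /= (inj_eq (@complexI _)) eqrXn2 ?ltW ?A_gt0 //.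
by rewrite !AE (inj_eq (addrI _)) eqr_nat => /eqP.
Qed.

Lemma node_neq0 i : node i != 0.
Proof. by rewrite sqrf_eq0 fmorph_eq0 gt_eqF ?A_gt0. Qed.

Lemma nodal_sq_root n z : root (nodal n \Po 'X^2) z =
  [exists i : 'I_n, z ^+ 2 == node i].
Proof. by rewrite /root horner_sq -root_nodal. Qed.

Lemma comp_sq_oppX (Q : {poly R[i]}) : (Q \Po 'X^2) \Po (- 'X) = Q \Po 'X^2.
Proof. by rewrite -comp_polyA comp_Xn_poly sqrrN. Qed.

(** Evenness comes from the variable [t^2] and regularity at infinity from the size bound. The poles
    are simple because the nodes are distinct and nonzero. *)
Lemma Fspace_quotient n (Q : {poly R[i]}) : (size Q <= n.+1)%N ->
  Fspace eps L (ofsq Q / ofsq (nodal n)).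
Proof.
move=> szQ; have Dn0 : nodal n \Po 'X^2 != 0 by rewrite comp_sq_eq0 nodal_neq0.
split.
- move=> z v [p [q [qz fE ->]]]; have q0 := horner_neq0 qz.
  have E := tofrac_divE Dn0 q0 fE.
  have q'z : (q \Po (- 'X)).[- z] != 0 by rewrite horner_comp !hornerE opprK.
  exists (p \Po (- 'X)), (q \Po (- 'X)); split => //; last first.
    by rewrite !horner_comp !hornerE opprK.
  apply/eqP; rewrite eqr_div ?tofrac_eq0 ?(horner_neq0 q'z) //.
  rewrite -!tofracM tofrac_eq -{1}[Q \Po _]comp_sq_oppX -{1}[nodal n \Po _]comp_sq_oppX.
  by rewrite -!comp_polyM E.
- exists (Q \Po 'X^2), (nodal n \Po 'X^2); split => //.
  rewrite size_nodal_sq (leq_trans (size_comp_poly_leq _ _)) // ltnS size_polyXn muln2.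
  by rewrite leq_double; case: (size Q) szQ.
move=> z nreg.
have /existsP[i /eqP z2] : [exists i : 'I_n, z ^+ 2 == node i].
  rewrite -nodal_sq_root; apply/negPn/negP => nr; apply: nreg.
  by eexists; exists (Q \Po 'X^2), (nodal n \Po 'X^2); split.
have z0 : z != 0 by rewrite -sqrf_eq0 z2 node_neq0.
split; last first.
  exists i.+1 => //; move/eqP: z2; rewrite /node eqf_sqr.
  by case/orP => /eqP ->; [left | right].
split => //.
pose E := \prod_(j < n | j != i) ((node j)%:P - 'X).
(* The factor [node i - t^2] splits as [- (t - z) (t + z)]. The cofactor of [t - z] does not vanish
   at [z], since [z != 0] and the other nodes differ from [z^2]. *)
have DE : nodal n \Po 'X^2 = ('X - z%:P) * (- ('X + z%:P) * (E \Po 'X^2)).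
  rewrite /nodal (bigD1 i) //= comp_polyM comp_polyB comp_polyC comp_polyX -z2.
  by rewrite mulrA; congr (_ * _); rewrite rmorphXn /=; ring.
have Ez : (- ('X + z%:P) * (E \Po 'X^2)).[z] != 0.
  rewrite hornerM horner_sq mulf_neq0 //.
    by rewrite !hornerE oppr_eq0 -mulr2n mulrn_eq0.
  rewrite horner_prod; apply/prodf_neq0 => j ji.
  by rewrite !hornerE z2 subr_eq0 (inj_eq node_inj).
exists ((Q \Po 'X^2).[z] / (- ('X + z%:P) * (E \Po 'X^2)).[z]).
exists (Q \Po 'X^2), (- ('X + z%:P) * (E \Po 'X^2)); split => //.
rewrite /ofsq DE tofracM /tvar /cst -tofracB.
have : tofrac ('X - z%:P) != 0 :> ratfun R by rewrite tofrac_eq0 polyXsubC_eq0.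
move: (tofrac ('X - z%:P)) (tofrac (- _ * _)) (tofrac _) => u w y u0.
by rewrite invfM mulrCA mulVKf.
Qed.

(** Cancelling the gcd lowers both sizes equally, so the bound at infinity survives. *)
Lemma Fspace_reduced f : Fspace eps L f ->
  exists p q : {poly R[i]}, [/\ q != 0, (size p <= size q)%N, coprimep p q & f = tofrac p / tofrac q].
Proof.
move=> [_ [p [q [q0 szpq ->]]] _]; pose d := gcdp p q.
have d0 : d != 0 by rewrite gcdp_eq0 negb_and q0 orbT.
have := divpK (dvdp_gcdl p q); have := divpK (dvdp_gcdr p q); rewrite -/d.
have := @coprimep_div_gcd _ p q; rewrite q0 orbT -/d => /(_ isT).
move: (p %/ d) (q %/ d) => p1 q1 cop qE pE.
have q10 : q1 != 0 by apply: contraNneq q0 => q10; rewrite -qE q10 mul0r.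
exists p1, q1; split => //.
  move: szpq; rewrite -pE -qE; have [->|p10] := eqVneq p1 0; first by rewrite size_poly0.
  rewrite !size_mul //; move: d0; rewrite -size_poly_gt0.
  by case: (size d) => // s _; rewrite !addnS /= leq_add2r.
by rewrite -pE -qE !tofracM -mulf_div divff ?mulr1 // tofrac_eq0.
Qed.

(** In lowest terms every root of the denominator [q] is a pole, hence simple and among the [± A m].
    So [q] divides some nodal polynomial in [t^2], and over that denominator the numerator must be
    even. *)
Lemma Fspace_quotientP f : Fspace eps L f ->
  exists n (Q : {poly R[i]}), (size Q <= n.+1)%N /\ f = ofsq Q / ofsq (nodal n).
Proof.
move=> Ff; have [p [q [q0 szpq cop fE]]] := Fspace_reduced Ff.
case: Ff => f_even _ f_poles.
have qNp z : root q z -> p.[z] != 0.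
  by move=> qz; apply: coprimep_root qz; rewrite coprimep_sym.
have q_pole z : root q z -> ~ regular_at f z.
  move=> qz [v [p' [q' [q'z fE' _]]]].
  move: fE'; rewrite fE => /(tofrac_divE q0 (horner_neq0 q'z)) /(congr1 (horner^~ z)).
  rewrite !hornerM (eqP qz) mulr0 => /eqP; rewrite mulf_eq0 (negPf q'z) orbF.
  by rewrite (negPf (qNp z qz)).
(* Regularity of [(t - z) f] at [z] gives [p * q' = p' * q2] with [p] and [q'] nonzero at [z], which
   excludes a second factor ['X - z]. *)
have q_simple z q2 : q = q2 * ('X - z%:P) -> q2.[z] != 0.
  move=> qE; have qz : root q z by rewrite qE rootM root_XsubC eqxx orbT.
  have [[_ [v [p' [q' [q'z fE' _]]]]] _] := f_poles z (q_pole z qz).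
  move: fE'; rewrite fE /tvar /cst -tofracB mulrA -tofracM.
  move=> /(tofrac_divE q0 (horner_neq0 q'z)); rewrite qE => E.
  have /(congr1 (horner^~ z)) : p * q' = p' * q2.
    apply: (@mulfI _ ('X - z%:P)); first by rewrite polyXsubC_eq0.
    by rewrite mulrA E mulrA mulrC.
  rewrite !hornerM; apply: contra_eqN => /eqP ->; rewrite mulr0.
  by rewrite mulf_neq0 // qNp.
have [r qE] := closed_field_poly_normal q.
have lc0 : lead_coef q != 0 by rewrite lead_coef_eq0.
have r_root z : z \in r -> root q z by rewrite qE rootZ // root_prod_XsubC.
have r_uniq : uniq r.
  apply: count_mem_uniq => z; have [zr|/count_memPn -> //] := boolP (z \in r).
  rewrite (permP (perm_to_rem zr)) /= eqxx.
  have /q_simple : q = lead_coef q *: \prod_(y <- rem z r) ('X - y%:P) * ('X - z%:P).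
    by rewrite {1}qE (perm_big _ (perm_to_rem zr)) big_cons /= -scalerAl mulrC.
  rewrite hornerZ mulf_eq0 negb_or => /andP[_]; rewrite -/(root _ _) root_prod_XsubC.
  by move=> /count_memPn ->.
have [n r_nodal] : exists n, all (root (nodal n \Po 'X^2)) r.
  elim: (r) r_root => [|z s IHs] sr; first by exists 0%N.
  have [y ys|n /allP Hn] := IHs _; first by apply: sr; rewrite inE ys orbT.
  have [_ [[//|m] _ zm]] := f_poles z (q_pole z (sr z (mem_head _ _))).
  (* A pole [± A m.+1] squares to [node m], a root of [nodal n] as soon as [n > m]. *)
  exists (maxn n m.+1); apply/allP => y; rewrite inE => /predU1P[->|/Hn].
    rewrite nodal_sq_root; apply/existsP; exists (Ordinal (leq_maxr n m.+1)).
    by case: zm => -> /=; rewrite ?sqrrN.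
  rewrite !nodal_sq_root => /existsP[i Hi]; apply/existsP.
  by exists (widen_ord (leq_maxl n m.+1) i).
have /dvdpP[w DE] : q %| nodal n \Po 'X^2.
  by rewrite qE dvdpZl // uniq_roots_dvdp // uniq_rootsE.
have Dn0 : nodal n \Po 'X^2 != 0 by rewrite comp_sq_eq0 nodal_neq0.
have w0 : w != 0 by apply: contraNneq Dn0 => w0; rewrite DE w0 mul0r.
pose P := w * p.
have fP : f = tofrac P / tofrac (nodal n \Po 'X^2).
  by rewrite fE DE !tofracM -mulf_div divff ?mul1r // tofrac_eq0.
have szP : (size P <= n.*2.+1)%N.
  rewrite -(size_nodal_sq node) DE /P; have [->|p0] := eqVneq p 0; first by rewrite mulr0 size_poly0.
  rewrite !size_mul //; move: w0; rewrite -size_poly_gt0.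
  by case: (size w) => // s _; rewrite !addSn /= leq_add2l.
move: (P) fP szP => {}P fP szP.
have P_even : forall z, P.[- z] = P.[z].
  move=> z; apply/eqP; rewrite -subr_eq0; apply/eqP.
  (* Evenness of [f] gives information only where the denominator is nonzero; the extra factor makes
     the product vanish at the other points too. *)
  pose E := ((P \Po (- 'X)) - P) * (nodal n \Po 'X^2).
  have : E = 0.
    apply: poly_fun_eq0 => {}z; rewrite hornerM.
    have [->|Dz] := eqVneq (nodal n \Po 'X^2).[z] 0; first by rewrite mulr0.
    have /f_even[p' [q' [q'z fE' vE]]] : has_value f z (P.[z] / (nodal n \Po 'X^2).[z]).
      by exists P, (nodal n \Po 'X^2).
    move: fE'; rewrite fP => /(tofrac_divE Dn0 (horner_neq0 q'z)).
    move=> /(congr1 (horner^~ (- z))); rewrite !hornerM [(_ \Po 'X^2).[- z]]horner_sq sqrrN -horner_sq => E'.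
    move/eqP: vE; rewrite eqr_div // => /eqP vE.
    suff -> : (P \Po (- 'X) - P).[z] = 0 by rewrite mul0r.
    apply/eqP; rewrite !hornerE horner_comp !hornerE subr_eq0; apply/eqP.
    by apply: (mulIf q'z); rewrite E' vE.
  move/eqP; rewrite mulf_eq0 (negPf Dn0) orbF => /eqP /(congr1 (horner^~ z)).
  by rewrite !hornerE horner_comp !hornerE.
exists n, (even_poly P); split; last by rewrite fP /ofsq -even_polyP.
(* Degree at most [2n] in [t] becomes degree at most [n] in [s]. *)
by rewrite (leq_trans (size_even_poly _)) // (leq_trans (uphalf_leq szP)) //= doubleK.
Qed.

End FspaceDescription.

(** * Uniqueness of coefficients and triangular changes of basis *)

Section Expansions.
Variable R : realType.
Implicit Types (b h : nat -> ratfun R) (c : nat -> R[i]) (F : set (ratfun R)).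

Lemma sum_widen b c n m : (n <= m)%N -> (forall k, (n <= k)%N -> c k = 0) ->
  \sum_(k < m) cst (c k) * b k = \sum_(k < n) cst (c k) * b k.
Proof.
move=> le_nm c0; pose T k := cst (c k) * b k.
rewrite -(big_mkord xpredT T) (big_cat_nat _ (n := n)) //= big_mkord.
rewrite [X in _ + X]big_nat [X in _ + X]big1 ?addr0 // => k /andP[le_nk _].
by rewrite /T c0 // rmorph0 mul0r.
Qed.

(** [coef] selects some expansion; freeness applied to the difference of two expansions shows that
    there is only one. *)
Lemma coef_basis F b phi c : is_basis F b -> expansion b phi c -> coef b phi = c.
Proof.
move=> [_ _ b_free] c_phi; rewrite /coef; case: xgetP => [c' _ /= c'_phi|/(_ c)//].
apply/funext => k; apply/eqP; rewrite -subr_eq0; apply/eqP.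
apply: (b_free (fun k => c' k - c k)).
case: c_phi c'_phi => [n [c0 phiE]] [n' [c'0 phiE']].
exists (maxn n n'); split=> [j|].
  by rewrite geq_max => /andP[nj n'j]; rewrite c0 // c'0 // subrr.
under eq_bigr do rewrite rmorphB mulrBl.
rewrite sumrB (sum_widen b (leq_maxr n n') c'0) (sum_widen b (leq_maxl n n') c0).
by rewrite -phiE -phiE' subrr.
Qed.

Section Triangular.
Variables (F : set (ratfun R)) (h b : nat -> ratfun R) (C : nat -> nat -> R[i]).
Hypothesis h_span : forall f, F f -> exists n c, f = \sum_(j < n) cst (c j) * h j.
Hypothesis h_free : forall n c, \sum_(j < n) cst (c j) * h j = 0 ->
  forall j, (j < n)%N -> c j = 0.
Hypothesis b_in : forall k, F (b k).
Hypothesis C_trig : forall k j, (k < j)%N -> C k j = 0.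
Hypothesis C_diag : forall k, C k k != 0.
Hypothesis bE : forall k, b k = \sum_(j < k.+1) cst (C k j) * h j.

Lemma trig_bE n k : (k < n)%N -> b k = \sum_(j < n) cst (C k j) * h j.
Proof. by move=> lt_kn; rewrite bE -(sum_widen h lt_kn) // => j; apply: C_trig. Qed.

(** Subtracting [c n / C n n] times [b n] removes [h n] and leaves a shorter combination. *)
Lemma trig_span n c : exists c', \sum_(j < n) cst (c j) * h j = \sum_(j < n) cst (c' j) * b j.
Proof.
elim: n c => [|n IHn] c; first by exists c; rewrite !big_ord0.
have [c' c'E] := IHn (fun j => c j - c n / C n n * C n j).
exists (fun j => if (j < n)%N then c' j else c n / C n n).
rewrite !big_ord_recr /= ltnn; under [in RHS]eq_bigr => j _ do rewrite ltn_ord.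
rewrite -c'E bE big_ord_recr /= mulrDr !mulrA -!rmorphM divfK //= addrA.
congr (_ + _); rewrite mulr_sumr -big_split /=; apply: eq_bigr => j _.
by rewrite rmorphB rmorphM mulrBl mulrA subrK.
Qed.

Lemma trig_free n c : \sum_(j < n) cst (c j) * b j = 0 -> forall j, (j < n)%N -> c j = 0.
Proof.
elim: n => [//|n IHn] sum0.
(* Among [b 0], ..., [b n] only [b n] involves [h n], with the nonzero coefficient [C n n]. *)
have cn0 : c n = 0.
  have : \sum_(j < n.+1) cst (\sum_(k < n.+1) c k * C k j) * h j = 0.
    rewrite -[RHS]sum0; under eq_bigr do rewrite rmorph_sum mulr_suml.
    rewrite exchange_big; apply: eq_bigr => k _ /=.
    rewrite (trig_bE (ltn_ord k)) mulr_sumr; apply: eq_bigr => j _.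
    by rewrite rmorphM mulrA.
  pose d j := \sum_(k < n.+1) c k * C k j.
  move=> /(@h_free n.+1 d) /(_ n (ltnSn n)); rewrite /d big_ord_recr /= big1 => [|k _].
    by rewrite add0r => /eqP; rewrite mulf_eq0 (negPf (C_diag n)) orbF => /eqP.
  by rewrite C_trig ?mulr0.
move=> j; rewrite ltnS leq_eqVlt => /predU1P[-> //|]; apply: IHn.
by move: sum0; rewrite big_ord_recr /= cn0 rmorph0 mul0r addr0.
Qed.

Lemma triangular_basis : is_basis F b.
Proof.
split=> // [phi Fphi|c [n [c0 /esym sum0]] k].
  have [n [c ->]] := h_span Fphi; have [c' ->] := trig_span n c.
  exists (fun j => if (j < n)%N then c' j else 0), n; split=> [k|].
    by rewrite leqNgt => /negPf ->.
  by apply: eq_bigr => j _; rewrite ltn_ord.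
by have [/c0 //|lt_kn] := leqP n k; apply: (trig_free sum0 lt_kn).
Qed.

End Triangular.
End Expansions.

(** One step of the telescoping below: [1 / w = 1 / wj + y / (wj * w)], scaled by [c / d]. *)
Lemma inv_shift (K : fieldType) (c d w wj y : K) : w != 0 -> wj != 0 -> d != 0 ->
  wj = w + y -> c / d / w = c / (d * wj) + c * y / (d * wj) / w.
Proof.
move=> w0 wj0 d0 E; have -> : y = wj - w by rewrite E addrC addKr.
by field; rewrite w0 wj0 d0.
Qed.

Lemma inv_sub_inv (K : fieldType) (t s : K) : t - s != 0 -> t + s != 0 ->
  (t - s)^-1 - (t + s)^-1 = - (2 * s) / (s ^+ 2 - t ^+ 2).
Proof.
move=> H1 H2; have -> : s ^+ 2 - t ^+ 2 = - ((t - s) * (t + s)) by ring.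
by field; rewrite oppr_eq0 mulf_neq0 // H1 H2.
Qed.

Lemma hyp_term_shuffle (K : fieldType) (s f C fc p q r u d : K) : fc != 0 -> C * fc = f ->
  s * f * (p * (q * r)) / (d * u) * (1 / fc) = s * C * p * (q * r / u) * d^-1.
Proof.
move=> fc0 <-; rewrite mul1r invfM.
transitivity (s * C * p * (q * r / u) * d^-1 * (fc * fc^-1)); first by ring.
by rewrite divff // mulr1.
Qed.

(** * Expansions of [e] and [g] in the Newton family, and the transition coefficients *)

Section Coefficients.
Variables (R : realType) (a eps : R) (L : nat).
Hypotheses (ha : -1 < a) (heps : 0 <= eps) (hL : (2 <= L)%N).

Local Notation node := (@node R eps L).
Local Notation h := (hbase node).
Local Notation b := (2 * eps).

Definition rcst (x : R) : ratfun R := cst x%:C.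
HB.instance Definition _ := GRing.RMorphism.copy rcst (@cst R \o real_complex R).

(** The part of the [j]-th coefficient of the series [g k] that is independent of [k]. *)
Definition kappa (j : nat) : R := poch L%:R j * poch (L%:R + a) j / poch (a + 1) j.

(** For [m >= 1] there is no [h 0] term, as [e m] vanishes at infinity. The factor [- 2 A_m] comes
    from merging the two simple fractions, and the Pochhammer symbols from [prod_node_sub]. *)
Definition ecoef (m j : nat) : R :=
  match m, j with
  | 0, _ => (j == 0)%:R
  | _, 0 => 0
  | m'.+1, j'.+1 => - (2 * A eps L m)
      * (poch (- m'%:R) j' * poch (2 * L%:R + b + m'%:R) j')
  end.

(** Each factor is a difference of squares, [(i - m) (2L + 2 eps + i + m)]. *)
Lemma prod_node_sub m j :
  \prod_(i < j) (node i - node m) = (poch (- m%:R) j * poch (2 * L%:R + b + m%:R) j)%:C.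
Proof.
rewrite /poch -big_split rmorph_prod; apply: eq_bigr => i _ /=.
by rewrite /node -!rmorphXn -rmorphB !AE; congr (_ %:C); ring.
Qed.

Lemma node_inv_telescope m j :
  (ofsq ((node m)%:P - 'X))^-1 =
    \sum_(i < j) cst (\prod_(l < i) (node l - node m)) * h i.+1
    + cst (\prod_(l < j) (node l - node m)) / ofsq (nodal node j) / ofsq ((node m)%:P - 'X).
Proof.
elim: j => [|j IHj].
  by rewrite /nodal !big_ord0 !rmorph1 divr1 mul1r add0r.
rewrite {1}IHj !big_ord_recr /= -addrA; congr (_ + _).
rewrite /hbase nodalS ofsqM [cst (_ * _)]rmorphM; apply: inv_shift.
- by rewrite ofsq_eq0 node_subX_neq0.
- by rewrite ofsq_eq0 node_subX_neq0.
- by rewrite ofsq_eq0 nodal_neq0.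
- by rewrite /= -ofsqC -ofsqD polyCB; congr ofsq; ring.
Qed.

Lemma e_expansion m : e eps L m = \sum_(j < m.+1) rcst (ecoef m j) * h j.
Proof.
case: m => [|m].
  by rewrite big_ord_recl big_ord0 addr0 rmorph1 mul1r /hbase /nodal big_ord0 rmorph1 invr1.
rewrite /e big_ord_recl rmorph0 mul0r add0r.
rewrite inv_sub_inv; first last.
- rewrite /tvar /cst -tofracD tofrac_eq0 -[X in _ + X]opprK -polyCN polyXsubC_eq0 //.
- by rewrite /tvar /cst -tofracB tofrac_eq0 polyXsubC_eq0.
have -> : cst (A eps L m.+1)%:C ^+ 2 - tvar R ^+ 2 = ofsq ((node m)%:P - 'X).
  by rewrite ofsqB ofsqC ofsqX [cst (_ ^+ 2)]rmorphXn.
(* At length [m.+1] the remainder contains [node m - node m], so the expansion is finite. *)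
rewrite (node_inv_telescope m m.+1) [X in cst X / _ / _]big_ord_recr /=.
rewrite subrr mulr0 rmorph0 !mul0r addr0 mulr_sumr.
apply: eq_bigr => i _; rewrite mulrA prod_node_sub; congr (_ * _).
by rewrite [RHS]rmorphM rmorphN [X in - X * _ = _](_ : _ = rcst (2 * A eps L m.+1)) // rmorphM rmorph_nat.
Qed.

Lemma L_a_gt0 : [/\ 0 < L%:R :> R, 0 < L%:R + a & 0 < a + 1].
Proof.
have L2 : 2 <= L%:R :> R by rewrite (ler_nat R 2).
by move: ha L2 => a1 L2; split; lra.
Qed.

Lemma kappa_gt0 j : 0 < kappa j.
Proof. by have [L0 La0 a0] := L_a_gt0; rewrite /kappa divr_gt0 ?mulr_gt0 ?poch_gt0. Qed.

Lemma g_expansion k : g a eps L k = \sum_(j < k.+1) rcst (gcoef b k j * kappa j) * h j.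
Proof.
apply: eq_bigr => j _; rewrite /hyp_term !big_cons !big_nil expr1n !mulr1.
rewrite pochN [k%:R + b]addrC.
have -> : cst (b + k%:R)%:C = rcst (k%:R + b) by rewrite addrC.
rewrite -!(rmorph_poch rcst).
have -> : poch (- tvar R + cst (L%:R + eps)%:C) j * (poch (tvar R + cst (L%:R + eps)%:C) j *
    rcst (poch (a + 1) j)) = ofsq (nodal node j) * rcst (poch (a + 1) j).
  rewrite mulrA; congr (_ * _); rewrite /poch -big_split rmorph_prod; apply: eq_bigr => i _ /=.
  rewrite ofsqB ofsqC ofsqX [cst (_ ^+ 2)]rmorphXn /= AE.
  have -> : cst (L%:R + eps + i%:R)%:C = cst (L%:R + eps)%:C + i%:R.
    by rewrite -[LHS]/(rcst _) rmorphD rmorph_nat.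
  by move: (cst _) (tvar R) (i%:R) => u t v; ring.
rewrite /gcoef /kappa !rmorphM fmorphV rmorph_sign rmorph_nat.
apply: hyp_term_shuffle; last by rewrite -natrM bin_ffact.
by rewrite -(rmorph_nat rcst) fmorph_eq0 pnatr_eq0 -lt0n fact_gt0.
Qed.

Lemma gcoef_trig k j : (k < j)%N -> gcoef b k j * kappa j = 0.
Proof. by move=> lt_kj; rewrite /gcoef bin_small // !(mulr0, mul0r). Qed.

Lemma gcoef_diag k : gcoef b k k * kappa k != 0.
Proof.
rewrite mulf_neq0 ?(gt_eqF (kappa_gt0 k)) // /gcoef binn mulr1 mulf_neq0 ?signr_eq0 //.
by rewrite poch_diag_neq0 // mulr_ge0.
Qed.

Lemma ecoef_trig m j : (m < j)%N -> ecoef m j = 0.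
Proof.
case: m j => [|m] [|j] //=; rewrite ltnS => lt_mj.
by rewrite pochN ffact_small // !(mulr0, mul0r).
Qed.

Lemma ecoef_diag m : ecoef m m != 0.
Proof.
case: m => [|m] /=; first exact: oner_neq0.
rewrite mulf_neq0 //; first by rewrite oppr_eq0 mulf_neq0 ?pnatr_eq0 // gt_eqF ?A_gt0.
rewrite mulf_neq0 //.
  by rewrite pochN ffactnn mulf_neq0 ?signr_eq0 // pnatr_eq0 -lt0n fact_gt0.
by rewrite poch_neq0 // -addrA ltr_pwDl ?addr_ge0 ?mulr_ge0 // mulr_gt0 // ltr0n (leq_trans _ hL).
Qed.

Lemma hbase_span f : Fspace eps L f ->
  exists n (c : nat -> R[i]), f = \sum_(j < n) cst (c j) * h j.
Proof.
move=> /Fspace_quotientP[n [Q [szQ ->]]].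
by have [c ->] := hbase_expand node szQ; exists n.+1, c.
Qed.

Lemma hbase_free n (c : nat -> R[i]) : \sum_(j < n) cst (c j) * h j = 0 ->
  forall j, (j < n)%N -> c j = 0.
Proof.
case: n => [//|n]; have [Q [_ -> Q0]] := hbase_sumE node n c.
move/eqP; rewrite mulf_eq0 invr_eq0 !ofsq_eq0 (negPf (nodal_neq0 _ _)) orbF.
by move/eqP/Q0.
Qed.

Lemma hbase_sum_in n (c : nat -> R[i]) :
  Fspace eps L (\sum_(j < n.+1) cst (c j) * h j).
Proof.
by have [Q [szQ -> _]] := hbase_sumE node n c; apply: Fspace_quotient.
Qed.

Lemma e_basis : is_basis (Fspace eps L) (e eps L).
Proof.
apply: (triangular_basis (h := h) (C := fun k j => (ecoef k j)%:C)).
- exact: hbase_span.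
- exact: hbase_free.
- by move=> k; rewrite e_expansion; apply: (hbase_sum_in k (fun j => (ecoef k j)%:C)).
- by move=> k j /ecoef_trig ->.
- by move=> k; rewrite fmorph_eq0 ecoef_diag.
- exact: e_expansion.
Qed.

Lemma g_basis : is_basis (Fspace eps L) (g a eps L).
Proof.
apply: (triangular_basis (h := h) (C := fun k j => (gcoef b k j * kappa j)%:C)).
- exact: hbase_span.
- exact: hbase_free.
- by move=> k; rewrite g_expansion; apply: (hbase_sum_in k (fun j => (gcoef b k j * kappa j)%:C)).
- by move=> k j /gcoef_trig ->.
- by move=> k; rewrite fmorph_eq0 gcoef_diag.
- exact: g_expansion.
Qed.

(** The composite of two expansions: [e m] in the [h j], and [h j] as the sum over [k] of
    [ginv b j k / kappa j] times [g k]. *)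
Definition transition (m k : nat) : R :=
  \sum_(j < m.+1) ecoef m j / kappa j * ginv b j k.

Lemma transition_gcoef m i : (i <= m)%N ->
  \sum_(k < m.+1) transition m k * (gcoef b k i * kappa i) = ecoef m i.
Proof.
move=> le_im; under eq_bigr do rewrite /transition mulr_suml.
rewrite exchange_big /=.
transitivity (\sum_(j < m.+1) ecoef m j / kappa j * kappa i * (j == i :> nat)%:R).
  apply: eq_bigr => j _; rewrite -(@ginv_gcoef _ b _ _ i _ (ltn_ord j)) ?mulr_ge0 // mulr_sumr.
  by apply: eq_bigr => k _; ring.
rewrite (bigD1 (Ordinal (le_im : (i < m.+1)%N))) //= eqxx mulr1 big1 => [|j ji].
  by rewrite addr0 divfK // gt_eqF ?kappa_gt0.
by rewrite (_ : (j == i :> nat) = false) ?mulr0 //; apply: negbTE.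
Qed.

Lemma e_in_g m : e eps L m = \sum_(k < m.+1) rcst (transition m k) * g a eps L k.
Proof.
have gE (k : 'I_m.+1) : g a eps L k = \sum_(i < m.+1) rcst (gcoef b k i * kappa i) * h i.
  apply: (trig_bE (C := fun k j => (gcoef b k j * kappa j)%:C)) => [k' j /gcoef_trig -> //||//].
  exact: g_expansion.
under eq_bigr do rewrite gE mulr_sumr.
rewrite exchange_big e_expansion; apply: eq_bigr => i _ /=.
have le_im : (i <= m)%N by rewrite -ltnS.
rewrite -(transition_gcoef le_im) rmorph_sum mulr_suml; apply: eq_bigr => k _.
by rewrite rmorphM mulrA.
Qed.

Lemma transition0 m k : (m < k)%N -> transition m k = 0.
Proof.
move=> lt_mk; apply: big1 => j _.
by rewrite /ginv bin_small ?mulr0 ?mul0r ?mulr0 // (leq_ltn_trans _ lt_mk) // -ltnS.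
Qed.

Lemma coef_eE m k : coef (g a eps L) (e eps L m) k = (transition m k)%:C.
Proof.
suff /(coef_basis g_basis) -> : expansion (g a eps L) (e eps L m) (fun k => (transition m k)%:C).
  by [].
exists m.+1; split; last exact: e_in_g.
by move=> j /transition0 ->.
Qed.

(** The terms with [j < k] vanish. After [j = k + l], [pochD] splits the Pochhammer symbols of
    length depending on [j] into a prefactor and a factor of the [l]-th term. *)
Lemma transitionE m k : (0 < k)%N -> (k <= m)%N -> transition m k =
  2 * (L%:R + eps + m%:R - 1)
  * poch (2 * L%:R + 2 * eps + m%:R - 1) k.-1
  * ((m.-1)`!%:R / (m - k)`!%:R)
  * (poch (a + 1) k
     / (poch L%:R k * poch (L%:R + a) k * poch (k%:R + 2 * eps) k))
  * hypergeom (m - k)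
      [:: k%:R - m%:R; k%:R + 1; k%:R + a + 1;
          2 * L%:R + 2 * eps + m%:R + k%:R - 2]
      [:: L%:R + k%:R; L%:R + a + k%:R; 2 * k%:R + 2 * eps + 1]
      1.
Proof.
have [L0 La0 a0] := L_a_gt0; have e0 := heps.
(* From here on [k] and [m] stand for the original indices minus one. *)
case: k m => [//|k] [//|m] _ le_km.
pose T j := ecoef m.+1 j / kappa j * ginv b j k.+1.
rewrite -[LHS]/(\sum_(j < m.+2) T j) (sum_shift le_km); last first.
  by move=> j lt_jk; rewrite /T /ginv bin_small // !(mulr0, mul0r).
rewrite /hypergeom mulr_sumr; apply: eq_bigr => -[l /= _] _.
have k0 := ler0n R k.
have kS : k.+1%:R = k%:R + 1 :> R by rewrite natr1.
have mS : m.+1%:R = m%:R + 1 :> R by rewrite natr1.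
rewrite /hyp_term !big_cons !big_nil expr1n !mulr1 poch_nat /T /ginv addKn.
rewrite -[ecoef _ _]/(- (2 * A eps L m.+1)
  * (poch (- m%:R) (k + l) * poch (2 * L%:R + b + m%:R) (k + l))) /kappa.
rewrite !(pochD _ k l) !(pochD _ k.+1 l).
have -> : 2 * L%:R + 2 * eps + m.+1%:R - 1 = 2 * L%:R + b + m%:R by rewrite mS; ring.
have -> : 2 * L%:R + 2 * eps + m.+1%:R + k.+1%:R - 2 = 2 * L%:R + b + m%:R + k%:R.
  by rewrite mS kS; ring.
have -> : k.+1%:R - m.+1%:R = - m%:R + k%:R :> R by rewrite mS kS; ring.
have -> : k.+1%:R + a + 1 = a + 1 + k.+1%:R by ring.
have -> : poch (- m%:R : R) k = (-1) ^+ k * (m`!%:R / (m - k)`!%:R).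
  rewrite pochN; congr (_ * _); rewrite -(ffact_fact (le_km : (k <= m)%N)) natrM mulfK //.
  by rewrite pnatr_eq0 -lt0n fact_gt0.
rewrite exprS subSS -[L%:R + eps + _ - 1]/(A eps L m.+1).
have nz (x : R) n : 0 < x -> poch x n != 0 by move=> /poch_neq0.
have F n : n`!%:R != 0 :> R by rewrite pnatr_eq0 -lt0n fact_gt0.
have sgn : (-1) ^+ k * (-1) ^+ k = 1 :> R by rewrite -expr2 sqrr_sign.
have nzs : [&& poch (L%:R : R) k.+1 != 0, poch (L%:R + a) k.+1 != 0, poch (a + 1) k.+1 != 0,
  poch (L%:R + k.+1%:R : R) l != 0, poch (L%:R + a + k.+1%:R) l != 0,
  poch (a + 1 + k.+1%:R) l != 0, poch (k.+1%:R + b) k.+1 != 0 &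
  poch (2 * k.+1%:R + b + 1) l != 0].
  by rewrite !nz // kS; lra.
move: nzs => /and4P[z1 z2 z3 /and5P[z4 z5 z6 z7 z8]].
move: (F m) (F (m - k)%N) (F l) => f1 f2 f3.
(* One sign comes from [poch (- m) k], the other from [ginv], whose remaining [-1] cancels the minus
   sign of [ecoef]. *)
transitivity ((-1) ^+ k * (-1) ^+ k * (2 * A eps L m.+1 * (poch (2 * L%:R + b + m%:R) k) * (m`!%:R / (m - k)`!%:R) *
  (poch (a + 1) k.+1 / (poch L%:R k.+1 * poch (L%:R + a) k.+1 * poch (k.+1%:R + b) k.+1)) *
  (poch (- m%:R + k%:R) l * ('C(k.+1 + l, k.+1)%:R *
    (poch (a + 1 + k.+1%:R) l * poch (2 * L%:R + b + m%:R + k%:R) l)) /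
   (poch (L%:R + k.+1%:R) l *
    (poch (L%:R + a + k.+1%:R) l * poch (2 * k.+1%:R + b + 1) l))))).
  by field; rewrite z1 z2 z3 z4 z5 z6 z7 z8 f2.
rewrite sgn.
by field; rewrite z1 z2 z4 z5 z7 z8 f2 f3.
Qed.

(** As [ecoef m 0 = 0], the sum starts at [j = 1]; the shift by one raises the parameters by 1, and
    the upper parameter 1 yields the [l!] that cancels the factorial of the series. *)
Lemma transition0E m : (0 < m)%N -> transition m 0 =
  - (2 * (L%:R + eps + m%:R - 1) * (a + 1) / (L%:R * (L%:R + a) * (2 * eps + 1)))
  * hypergeom m.-1
      [:: 1 - m%:R; 1; a + 2; 2 * L%:R + 2 * eps + m%:R - 1]
      [:: L%:R + 1; L%:R + a + 1; 2 * eps + 2]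
      1.
Proof.
have [L0 La0 a0] := L_a_gt0; have e0 := heps.
case: m => [//|m] _; pose T j := ecoef m.+1 j / kappa j * ginv b j 0.
rewrite -[LHS]/(\sum_(j < m.+2) T j) big_ord_recl {1}/T /= !mul0r add0r.
rewrite /hypergeom mulr_sumr; apply: eq_bigr => -[l /= _] _.
have -> : T (bump 0 l) = - (2 * A eps L m.+1)
    * (poch (- m%:R) l * poch (2 * L%:R + b + m%:R) l) / kappa l.+1 * ginv b l.+1 0 by [].
rewrite /hyp_term !big_cons !big_nil expr1n !mulr1 poch1 /ginv /kappa bin0 poch0 subn0.
have mS : m.+1%:R = m%:R + 1 :> R by rewrite natr1.
have -> : 2 * L%:R + 2 * eps + m.+1%:R - 1 = 2 * L%:R + b + m%:R by rewrite mS; ring.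
have -> : 1 - m.+1%:R = - m%:R :> R by rewrite mS; ring.
rewrite -[L%:R + eps + _ - 1]/(A eps L m.+1) !pochSl mulr0 add0r.
have -> : b + 1 + 1 = 2 * eps + 2 by ring.
have -> : a + 1 + 1 = a + 2 by ring.
have F : l`!%:R != 0 :> R by rewrite pnatr_eq0 -lt0n fact_gt0.
have z1 : poch (L%:R + 1 : R) l != 0 by apply: poch_neq0; lra.
have z2 : poch (L%:R + a + 1) l != 0 by apply: poch_neq0; lra.
have z3 : poch (a + 2) l != 0 by apply: poch_neq0; lra.
have z4 : poch (2 * eps + 2) l != 0 by apply: poch_neq0; lra.
have y1 : (L%:R : R) != 0 by rewrite gt_eqF.
have y2 : L%:R + a != 0 by rewrite gt_eqF.
have y3 : a + 1 != 0 by rewrite gt_eqF.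
have y4 : 2 * eps + 1 != 0 by rewrite gt_eqF //; lra.
by field; rewrite F z1 z2 z3 z4 y1 y2 y3 y4.
Qed.

End Coefficients.

Theorem theoremC (R : realType) (a eps : R) (L : nat)
    (ha : -1 < a) (heps : 0 <= eps) (hL : (2 <= L)%N) :
  [/\ is_basis (Fspace eps L) (e eps L),
      is_basis (Fspace eps L) (g a eps L),
      (forall m k : nat, (1 <= m)%N -> (1 <= k)%N ->
        coef (g a eps L) (e eps L m) k =
        (if (k <= m)%N then
           2 * (L%:R + eps + m%:R - 1)
           * poch (2 * L%:R + 2 * eps + m%:R - 1) k.-1
           * ((m.-1)`!%:R / (m - k)`!%:R)
           * (poch (a + 1) k
              / (poch L%:R k * poch (L%:R + a) k * poch (k%:R + 2 * eps) k))
           * hypergeom (m - k)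
               [:: k%:R - m%:R; k%:R + 1; k%:R + a + 1;
                   2 * L%:R + 2 * eps + m%:R + k%:R - 2]
               [:: L%:R + k%:R; L%:R + a + k%:R; 2 * k%:R + 2 * eps + 1]
               1
         else 0)%:C)
    & (forall m : nat, (1 <= m)%N ->
        coef (g a eps L) (e eps L m) 0 =
        (- (2 * (L%:R + eps + m%:R - 1) * (a + 1)
            / (L%:R * (L%:R + a) * (2 * eps + 1)))
         * hypergeom m.-1
             [:: 1 - m%:R; 1; a + 2; 2 * L%:R + 2 * eps + m%:R - 1]
             [:: L%:R + 1; L%:R + a + 1; 2 * eps + 2]
             1)%:C)].
Proof.
split; first exact: e_basis.
- exact: g_basis.
- move=> m k m1 k1; rewrite coef_eE //; congr _%:C.
  by case: leqP => [le_km|/transition0 -> //]; rewrite transitionE.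
- by move=> m m1; rewrite coef_eE // transition0E.
Qed.
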